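(* Let $P$ be a qoset, and let $x\in P$. Consider the following assertions: (1) $x$ is strongly irreducible in $P$; (2) $x$ is relatively-maximal in $P$; (3) $x$ is irreducible in $P$. Then (1) $\Rightarrow$ (2) $\Rightarrow$ (3). Moreover: - if $P$ is Riesz, then (1) $\Leftrightarrow$ (2) $\Leftrightarrow$ (3); - if $P$ is a semilattice, or if every principal filter $\uparrow y$ of $P$ is finite, then (1) $\Rightarrow$ (2) $\Leftrightarrow$ (3).
   Context: A qoset $(P,\leqslant)$ is a set with a reflexive transitive relation; $x\sim y$ means $x\leqslant y$ and $y\leqslant x$; $x<y$ means $x\leqslant y$ and $y\not\leqslant x$; $[x]$ is the $\sim$-class of $x$ and $[A]=\bigcup_{a\in A}[a]$. $\uparrow y=\{z:y\leqslant z\}$. $A^{\wedge}$ is the set of all infima (greatest lower bounds) of $A$ in $P$. A filter is a nonempty upper subset in which any two elements have a lower bound belonging to it. $\mathrm{Max}\,A$ is the set of $x\in A$ such that $x\leqslant y$ implies $x\sim y$ for all $y\in A$. An element $x$ is strongly irreducible if $\{y\in P:x<y\}$ is a filter; relatively-maximal if $x\in\mathrm{Max}(P\setminus T)$ for some filter $T$ of $P$; irreducible if, whenever $x\in F^{\wedge}$ for some finite (possibly empty) subset $F\subseteq P$, we have $x\in[F]$. A semilattice is a poset in which every nonempty finite subset has an infimum. A qoset is Riesz if, whenever $F,F'$ are finite (possibly empty) subsets with $f\leqslant f'$ for all $f\in F,f'\in F'$, there is some $x$ with $f\leqslant x\leqslant f'$ for all $f\in F$, $f'\in F'$. *)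

(* Defs.v *)
From mathcomp Require Import all_boot all_order.
From mathcomp Require Import boolp classical_sets functions cardinality.

Set Implicit Arguments.
Unset Strict Implicit.
Unset Printing Implicit Defensive.

Local Open Scope classical_set_scope.
Local Open Scope order_scope.

(* [preorderType] is a carrier with a reflexive transitive relation [<=], and
   its [x < y] is [(x <= y) && ~~ (y <= x)] (see [Order.lt_def]), which is the
   strict relation of a qoset. *)

Section Qoset.
Context {d : Order.disp_t} {P : preorderType d}.
Implicit Types (x y : P) (A T : set P).

Definition qequiv x y : Prop := x <= y /\ y <= x.

Definition saturation A : set P := [set x | exists2 a, A a & qequiv a x].

Definition upset_of y : set P := [set z | y <= z].

Definition lower_bounds A : set P := [set l | forall a, A a -> l <= a].

(* The library's [infimums] requires antisymmetry; here several ~-equivalent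
   infima may exist, and those of the empty set are the greatest elements. *)
Definition infima A : set P :=
  [set x | lower_bounds A x /\ forall l, lower_bounds A l -> l <= x].

Definition is_filter T : Prop :=
  [/\ T !=set0,
      forall x y, T x -> x <= y -> T y
    & forall x y, T x -> T y -> exists z, [/\ T z, z <= x & z <= y]].

Definition Max A : set P :=
  [set x | A x /\ forall y, A y -> x <= y -> qequiv x y].

Definition strongly_irreducible x : Prop := is_filter [set y | x < y].

Definition relatively_maximal x : Prop :=
  exists2 T : set P, is_filter T & Max (~` T) x.

Definition irreducible x : Prop :=
  forall F : set P, finite_set F -> infima F x -> saturation F x.

End Qoset.

Definition is_semilattice d (P : preorderType d) : Prop :=
  antisymmetric (<=%O : rel P) /\
  forall F : set P, finite_set F -> F !=set0 -> infima F !=set0.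

Definition is_Riesz d (P : preorderType d) : Prop :=
  forall F F' : set P, finite_set F -> finite_set F' ->
    (forall f f', F f -> F' f' -> f <= f') ->
    exists x : P, (forall f, F f -> f <= x) /\ (forall f', F' f' -> x <= f').

(* Main.v *)
Require Import Defs.
From mathcomp Require Import all_boot all_order.
From mathcomp Require Import boolp classical_sets functions cardinality.

(** Everything is controlled by the set U of the strict upper bounds of x.

    A filter T witnesses that x is relatively maximal exactly when x lies
    outside T and U lies inside T.  So a strongly irreducible element is
    relatively maximal by the choice T = U.  A relatively maximal element is
    irreducible because a finite set F with infimum x, none of whose members is
    equivalent to x, lies in U, hence in T; a lower bound of F taken in T is
    below x, which would put x in T.

    Irreducibility is used only through one consequence: a finite subset F of U
    cannot have x as an infimum, and since x is a lower bound of F, there is a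
    lower bound of F that is not below x ([irreducible_escape]).  The converse
    implications then differ only in how such bounds are turned into a filter.
    - Riesz: interpolating x and that lower bound under F gives a lower bound
      of F which lies again in U.  With F empty and F a pair this says that U
      is a filter.
    - U finite (in particular when the principal filters are finite): with
      F = U, the lower bound generates a principal filter that works.
    - Semilattice: the filter generated by U consists of the elements above
      the infimum of a nonempty finite subset of U, and it avoids x for the
      same reason.  It is nonempty when U is; an empty U is finite, and the
      previous case applies. *)

Import Order.PreorderTheory.
Local Open Scope classical_set_scope.
Local Open Scope order_scope.

Section IrreducibleElements.
Context {d : Order.disp_t} {P : preorderType d}.
Implicit Types (x y : P) (F T : set P).

Local Notation above x := [set y | x < y].

Lemma filter_finite_lower_bound T F :
  is_filter T -> finite_set F -> F `<=` T ->
  exists2 t, T t & lower_bounds F t.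
Proof.
move=> [[t0 Tt0] _ Tdir] /finite_seqP[s ->{F}].
elim: s => [|a s IHs] sT; first by exists t0.
have [t Tt t_lb] : exists2 t, T t & lower_bounds [set` s] t.
  by apply: IHs => y /= ys; apply: sT; rewrite /= inE ys orbT.
have Ta : T a by apply: sT; rewrite /= inE eqxx.
have [u [Tu ua ut]] := Tdir a t Ta Tt.
exists u => // y /=; rewrite inE => /orP[/eqP-> //|ys].
exact: le_trans ut (t_lb y ys).
Qed.

Lemma relatively_maximal_of_filter x T :
  is_filter T -> above x `<=` T -> ~ T x -> relatively_maximal x.
Proof.
move=> Tfilter UT Tx; exists T => //; split=> // y Ty xy; split=> //.
by apply: contrapT => /negP yx; apply: Ty; apply: UT; rewrite /= lt_leAnge xy.
Qed.

Lemma strongly_irreducible_relatively_maximal x :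
  strongly_irreducible x -> relatively_maximal x.
Proof.
by move=> Ufilter; apply: (relatively_maximal_of_filter _ _ Ufilter) => //=;
  rewrite ltxx.
Qed.

Lemma relatively_maximal_irreducible x :
  relatively_maximal x -> irreducible x.
Proof.
move=> [T Tfilter [Tx xmax]] F Ffin [x_lb x_glb].
apply: contrapT => xF; apply: Tx.
have FT : F `<=` T.
  move=> f Ff; apply: contrapT => Tf; apply: xF; exists f => //.
  by have [xf fx] := xmax f Tf (x_lb f Ff).
have [t Tt t_lb] := filter_finite_lower_bound _ _ Tfilter Ffin FT.
by have [_ Tup _] := Tfilter; apply: (Tup t) => //; apply: x_glb.
Qed.

(** If every lower bound of F were below x, then x would be an infimum of F,
    hence equivalent to a member of F, although they all lie strictly above. *)
Lemma irreducible_escape x F :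
  irreducible x -> finite_set F -> F `<=` above x ->
  exists2 l, lower_bounds F l & ~ l <= x.
Proof.
move=> xirr Ffin FU; apply: contrapT => noesc.
have [f Ff [fx _]] : saturation F x.
  apply: xirr => //; split=> [f /FU/ltW //|l l_lb].
  by apply: contrapT => lx; apply: noesc; exists l.
by have := FU f Ff; rewrite /= lt_leAnge fx andbF.
Qed.

Lemma Riesz_irreducible_lower_bound x F :
  is_Riesz P -> irreducible x -> finite_set F -> F `<=` above x ->
  exists2 w, x < w & lower_bounds F w.
Proof.
move=> riesz xirr Ffin FU.
have [l l_lb lx] := irreducible_escape _ _ xirr Ffin FU.
have [|w [xl_w w_lb]] := riesz [set x; l] F (finite_set2 x l) Ffin.
  by move=> _ f [] -> Ff; [exact: ltW (FU f Ff) | exact: l_lb].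
exists w => //; rewrite lt_leAnge xl_w /=; last by left.
(* w is above l, so it cannot be below x. *)
by apply/negP => wx; apply: lx; apply: le_trans wx; apply: xl_w; right.
Qed.

Lemma Riesz_irreducible_strongly_irreducible x :
  is_Riesz P -> irreducible x -> strongly_irreducible x.
Proof.
move=> riesz xirr; split=> [|y z /= xy yz|y z /= xy xz].
- have [w xw _] : exists2 w, x < w & lower_bounds set0 w.
    by apply: Riesz_irreducible_lower_bound => // y [].
  by exists w.
- exact: lt_le_trans xy yz.
- have [|w xw w_lb] := Riesz_irreducible_lower_bound x [set y; z] riesz xirr
    (finite_set2 y z); first by move=> _ [] ->.
  by exists w; split=> //; apply: w_lb; [left | right].
Qed.

Lemma upset_of_is_filter y : is_filter (upset_of y).
Proof.
split=> [|u v yu uv|u v yu yv]; first by exists y; apply: lexx.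
- exact: le_trans yu uv.
- by exists y; split=> //; apply: lexx.
Qed.

Lemma finite_above_irreducible_relatively_maximal x :
  finite_set (above x) -> irreducible x -> relatively_maximal x.
Proof.
move=> Ufin xirr.
have [l l_lb lx] := irreducible_escape _ _ xirr Ufin (fun _ => id).
exact: (relatively_maximal_of_filter _ _ (upset_of_is_filter l)).
Qed.

(** When [F] has an infimum, the condition on [z] says that [z] is above it;
    quantifying over all lower bounds avoids choosing an infimum. *)
Definition generated_filter (U : set P) : set P :=
  [set z | exists F, [/\ finite_set F, F !=set0, F `<=` U
                       & forall l, lower_bounds F l -> l <= z]].

Lemma sub_generated_filter (U : set P) : U `<=` generated_filter U.
Proof.
move=> u Uu; exists [set u]; split=> [||_ -> //|l]; last exact.
- exact: finite_set1.
- by exists u.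
Qed.

Lemma generated_filter_is_filter (U : set P) :
  is_semilattice P -> U !=set0 -> is_filter (generated_filter U).
Proof.
move=> [_ inf_ex] [u0 Uu0]; split.
- by exists u0; apply: sub_generated_filter.
- move=> y z [F [Ffin F0 FU Fy]] yz; exists F; split=> // l /Fy ly.
  exact: le_trans ly yz.
- move=> y z [F [Ffin [f Ff] FU Fy]] [G [Gfin G0 GU Gz]].
  have FGfin : finite_set (F `|` G) by rewrite finite_setU.
  have FG0 : F `|` G !=set0 by exists f; left.
  have [m [m_lb m_glb]] := inf_ex _ FGfin FG0.
  exists m; split.
  + by exists (F `|` G); split=> // w [/FU|/GU].
  + by apply: Fy => w Fw; apply: m_lb; left.
  + by apply: Gz => w Gw; apply: m_lb; right.
Qed.

Lemma semilattice_irreducible_relatively_maximal x :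
  is_semilattice P -> irreducible x -> relatively_maximal x.
Proof.
move=> semil xirr.
have [U0|U0] := eqVneq (above x) set0.
  apply: finite_above_irreducible_relatively_maximal => //.
  by rewrite U0; apply: finite_set0.
apply: (relatively_maximal_of_filter x (generated_filter (above x))).
- by apply: generated_filter_is_filter => //; apply/set0P.
- exact: sub_generated_filter.
- move=> [F [Ffin _ FU Fx]].
  by have [l /Fx] := irreducible_escape _ _ xirr Ffin FU.
Qed.

End IrreducibleElements.

Theorem corollary7p6 (d : Order.disp_t) (P : preorderType d) (x : P) :
  [/\ (strongly_irreducible x -> relatively_maximal x) /\
      (relatively_maximal x -> irreducible x),
      is_Riesz P ->
        (strongly_irreducible x <-> relatively_maximal x) /\
        (relatively_maximal x <-> irreducible x)
    & is_semilattice P \/ (forall y : P, finite_set (upset_of y)) ->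
        (strongly_irreducible x -> relatively_maximal x) /\
        (relatively_maximal x <-> irreducible x)].
Proof.
have h12 := strongly_irreducible_relatively_maximal x.
have h23 := relatively_maximal_irreducible x.
split=> [//|riesz|semil_or_fin].
- have h31 := Riesz_irreducible_strongly_irreducible x riesz.
  by split; split=> // h; [apply/h31/h23 | apply/h12/h31].
- split=> //; split=> // xirr; case: semil_or_fin => [semil|upfin].
  + exact: semilattice_irreducible_relatively_maximal.
  + apply: finite_above_irreducible_relatively_maximal => //.
    by apply: sub_finite_set (upfin x) => y /ltW.
Qed.
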